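(* Let $C$ be a Cantor fan and let $L$ be a Lelek fan. Then every embedding $f:C\to L$ admits a retraction, i.e. for every embedding $f:C\to L$ there is a continuous map $r:L\to f(C)$ with $r(y)=y$ for all $y\in f(C)$.
   Context: A continuum is a nonempty compact connected metric space. A dendroid is an arcwise connected, hereditarily unicoherent continuum. A point $x$ of a dendroid $X$ is a ramification point if $x$ is the top (the branch point) of some simple triod in $X$. A fan is a dendroid with at most one ramification point; this point, if it exists, is called the top of the fan. For a fan $X$, a point $x$ is an end point of $X$ if $x$ is an end point of every arc in $X$ containing $x$; $E(X)$ denotes the set of end points of $X$. A fan $X$ with top $v$ is smooth if for every $x\in X$ and every sequence $x_n\to x$ in $X$, the arcs from $v$ to $x_n$ converge (in the Hausdorff metric) to the arc from $v$ to $x$. A Lelek fan is a smooth fan $X$ with $\mathrm{Cl}(E(X))=X$. A Cantor fan is a continuum homeomorphic to $\bigcup_{c\in C}A_c\subseteq\mathbb R^2$, where $C\subseteq[0,1]$ is the Cantor middle-third set and $A_c$ is the straight segment from $(\tfrac12,0)$ to $(c,1)$. An embedding is a continuous map that is a homeomorphism onto its image. A retraction from a space $X$ onto a subspace $Y$ is a continuous map $r:X\to Y$ with $r(y)=y$ for all $y\in Y$; an embedding $f:X\to Z$ admits a retraction if there is a retraction from $Z$ onto $f(X)$. *)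

(* Defs.v *)
From HB Require Import structures.
From mathcomp Require Import all_boot all_order all_algebra.
From mathcomp Require Import all_classical all_reals all_analysis.
Set Implicit Arguments. Unset Strict Implicit. Unset Printing Implicit Defensive.
Import Order.TTheory GRing.Theory Num.Theory.
Import numFieldNormedType.Exports.
Local Open Scope classical_set_scope.
Local Open Scope ring_scope.

Section Fans.
Variable R : realType.

(* A continuum: nonempty compact connected metric space
   (pseudometric + Hausdorff = metric). *)
Definition continuum (X : pseudoMetricType R) : Prop :=
  hausdorff_space X /\ compact [set: X] /\ connected [set: X] /\ [set: X] !=set0.

Definition subcontinuum (X : pseudoMetricType R) (A : set X) : Prop :=
  A !=set0 /\ compact A /\ connected A.

(* A is an arc with end points a and b: image of [0,1] under a continuous
   injective map sending 0 to a and 1 to b (an embedding, since [0,1] is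
   compact and X Hausdorff). *)
Definition is_arc (X : pseudoMetricType R) (A : set X) (a b : X) : Prop :=
  exists g : R -> X,
    {within `[0, 1]%classic, continuous g} /\
    (forall s t, `[0, 1]%classic s -> `[0, 1]%classic t -> g s = g t -> s = t) /\
    g @` `[0, 1]%classic = A /\ g 0 = a /\ g 1 = b.

Definition dendroid (X : pseudoMetricType R) : Prop :=
  continuum X /\
  (forall x y : X, x <> y -> exists A, is_arc A x y) /\
  (forall A B : set X, subcontinuum A -> subcontinuum B -> connected (A `&` B)).

Definition ramification_point (X : pseudoMetricType R) (x : X) : Prop :=
  exists (A1 A2 A3 : set X) (a1 a2 a3 : X),
    [/\ is_arc A1 x a1, is_arc A2 x a2 & is_arc A3 x a3] /\
    [/\ A1 `&` A2 = [set x], A1 `&` A3 = [set x] & A2 `&` A3 = [set x]].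

Definition fan (X : pseudoMetricType R) : Prop :=
  dendroid X /\
  (forall x y : X, ramification_point x -> ramification_point y -> x = y).

Definition end_point (X : pseudoMetricType R) (x : X) : Prop :=
  forall (A : set X) (a b : X), is_arc A a b -> A x -> x = a \/ x = b.

Definition varc (X : pseudoMetricType R) (v x : X) (A : set X) : Prop :=
  (x = v /\ A = [set v]) \/ (x <> v /\ is_arc A v x).

Definition eps_nbhd (X : pseudoMetricType R) (S : set X) (e : R) : set X :=
  [set y | exists2 s, S s & ball s e y].

Definition hausdorff_cvg (X : pseudoMetricType R) (An : nat -> set X) (A : set X)
  : Prop :=
  forall e : R, 0 < e ->
    \forall n \near \oo, An n `<=` eps_nbhd A e /\ A `<=` eps_nbhd (An n) e.

Definition smooth_fan (X : pseudoMetricType R) (v : X) : Prop :=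
  fan X /\ ramification_point v /\
  forall (x : X) (u : nat -> X) (Au : nat -> set X) (A : set X),
    u @ \oo --> x -> (forall n, varc v (u n) (Au n)) -> varc v x A ->
    hausdorff_cvg Au A.

Definition lelek_fan (X : pseudoMetricType R) : Prop :=
  exists v : X, smooth_fan v /\ closure [set x : X | end_point x] = [set: X].

(* Cantor middle-third set: ternary expansions with digits in {0,2} *)
Definition cantor_set : set R :=
  [set x | exists d : nat -> bool,
      (fun n : nat => \sum_(0 <= k < n) (((d k)%:R * 2) / 3 ^+ k.+1)) @ \oo --> x].

Definition std_cantor_fan : set (R * R) :=
  [set p | exists c t : R, [/\ cantor_set c, 0 <= t <= 1 &
                                p = ((1 - t) / 2 + t * c, t)]].

Definition embedding (X Y : topologicalType) (f : X -> Y) : Prop :=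
  continuous f /\ injective f /\
  exists g : Y -> X, {within range f, continuous g} /\ cancel f g.

Definition cantor_fan (X : pseudoMetricType R) : Prop :=
  continuum X /\ exists h : X -> R * R, embedding h /\ range h = std_cantor_fan.

End Fans.

(* Main.v *)
Require Import Defs.
From HB Require Import structures.
From mathcomp Require Import all_boot all_order all_algebra.
From mathcomp Require Import all_classical all_reals all_analysis.
From mathcomp Require Import lra.
Set Implicit Arguments. Unset Strict Implicit. Unset Printing Implicit Defensive.
Import Order.TTheory GRing.Theory Num.Theory.
Import numFieldNormedType.Exports.
Local Open Scope classical_set_scope.
Local Open Scope ring_scope.

(** Let [v] be the top of the Lelek fan [L]; the embedding sends the top of the
    Cantor fan to [v], as the top of a fan is its only ramification point.
    A point of the Cantor fan is given by a digit sequence [d] (the leg) and a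
    height [t].  By Tietze's theorem the height extends from the closed set
    [f(C)] to a continuous [s : L -> [0, 1]].  The retraction maps [x] to the
    point of [f(C)] with height [s x] on the leg [c x], where
    [c : L \ {v} -> bool^nat] is a continuous extension of the leg coordinate;
    at [v] the choice of [c] is irrelevant because [s v = 0].

    To extend one digit, the end points of the legs where it is [1] have to be
    separated from those where it is [0] by a clopen subset of [L \ {v}].
    Smoothness makes [{x | [v, x] is included in O}] open for [O] open, so
    [L \ {v}] is the increasing union of compact sets [Y n] that are upward
    closed along the legs.  By hereditary unicoherence a continuum that misses
    [v] lies on one leg, hence in each [Y n] disjoint unions of legs are
    separated by clopen sets, and the clopen sets chosen for successive [n] can
    be made compatible. *)

(** * Clopen separation in compact Hausdorff spaces *)

Section CompactSeparation.
Variable T : topologicalType.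

(** On [M] the closed sets [F] and [G] are complementary, so the trace of [F] is relatively
    clopen. *)
Lemma connected_closed_sub (M F G : set T) :
  connected M -> closed F -> closed G -> M `<=` F `|` G ->
  M `&` F `&` G = set0 -> M `&` F !=set0 -> M `<=` F.
Proof.
move=> cM cF cG MFG MFG0 MF0.
suff <- : M `&` F = M by move=> x [].
apply: cM => //; last by exists F.
exists (~` G); first exact: closed_openC.
apply/seteqP; split=> x [Mx Fx]; split=> //.
  by move=> Gx; suff : set0 x by []; rewrite -MFG0.
by case: (MFG _ Mx).
Qed.

Hypothesis hT : hausdorff_space T.
Hypothesis cT : compact [set: T].

(** Otherwise the differences of the members of [F] with [G] generate a proper filter. A cluster
    point lies in every closed member, hence in the open set [G], which those differences miss. *)
Lemma filtered_closed_sub_open (F : set (set T)) (G : set T) :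
  F !=set0 -> (forall A B, F A -> F B -> F (A `&` B)) ->
  (forall A, F A -> closed A) -> open G -> \bigcap_(A in F) A `<=` G ->
  exists2 A, F A & A `<=` G.
Proof.
move=> F0 FI Fcl oG FG; apply: contrapT => nFG.
have PF : ProperFilter (filter_from F (fun A => A `\` G)).
  apply: filter_from_proper; first apply: filter_from_filter => //.
    move=> A B FA FB; exists (A `&` B); first exact: FI.
    by move=> x [[? ?] ?]; split.
  move=> A FA; apply: contrapT => nA; apply: nFG; exists A => // x Ax.
  by apply: contrapT => nGx; apply: nA; exists x.
have [|p [_ clp]] := cT PF; first exact: filterT.
have Gp : G p.
  apply: FG => A FA; apply: (Fcl _ FA) => B Bp.
  have [|q [[Aq _] Bq]] := clp (A `\` G) B _ Bp; first by exists A.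
  by exists q.
case: F0 => A FA.
have [||q [[_ nGq] Gq]] := clp (A `\` G) G; [by exists A| | by []].
exact: open_nbhs_nbhs.
Qed.

Lemma disjoint_closed_opens (A B : set T) :
  closed A -> closed B -> A `&` B = set0 ->
  exists U V, [/\ open U, open V, A `<=` U, B `<=` V & U `&` V = set0].
Proof.
move=> cA cB AB0; have AnB : set_nbhs A (~` B).
  by apply/set_nbhsP; exists (~` B); split=> //;
    [exact: closed_openC|exact/disjoints_subset].
have [N /set_nbhsP[U [oU AU UN]] NB] := compact_normal hT cT cA AnB.
exists U, (~` closure N); split=> //.
- exact/closed_openC/closed_closure.
- by move=> x Bx /NB.
- apply/disjoints_subset; rewrite setCK.
  exact: (subset_trans UN (@subset_closure _ N)).
Qed.

Variable Y : set T.
Hypothesis cY : closed Y.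

(** As [Y] is closed, relative clopenness can be tested by closedness in [T], without the subspace
    topology. *)
Definition clopen_in (A : set T) := [/\ A `<=` Y, closed A & closed (Y `\` A)].

Lemma clopen_inT : clopen_in Y.
Proof. by split=> //; rewrite setDv; exact: closed0. Qed.

Lemma clopen_inC A : clopen_in A -> clopen_in (Y `\` A).
Proof.
move=> [AY cA cYA]; split=> [x []|//|] //.
by rewrite setDD setIC; move/setIidPl : AY => ->.
Qed.

Lemma clopen_inI A B : clopen_in A -> clopen_in B -> clopen_in (A `&` B).
Proof.
move=> [AY cA cYA] [BY cB cYB]; split; first by move=> x [/AY].
  exact: closedI.
by rewrite setDIr; exact: closedU.
Qed.

(** Suppose that [K] splits into disjoint closed sets [B], containing [x], and [C], with disjoint
    open neighbourhoods [U] and [V]. By compactness some clopen [A] around [x] lies in their union.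
    Its trace on [U] is again clopen and contains [x], so it contains [K], and [C] is empty. *)
Lemma quasicomponent_connected x : Y x ->
  connected (\bigcap_(A in [set A | clopen_in A /\ A x]) A).
Proof.
move=> Yx; set F := [set A | _]; set K := \bigcap_(A in F) A.
have F0 : F !=set0 by exists Y; split => //; exact: clopen_inT.
have FI A B : F A -> F B -> F (A `&` B).
  by move=> [? ?] [? ?]; split=> //; exact: clopen_inI.
have Fcl A : F A -> closed A by move=> [[]].
have cK : closed K by exact: closed_bigI.
have Kx : K x by move=> A [].
have key B C : closed B -> closed C -> B `&` C = set0 -> K = B `|` C ->
    B x -> C = set0.
  move=> cB cC BC0 KBC Bx.
  have [U [V [oU oV BU CV UV0]]] := disjoint_closed_opens cB cC BC0.
  have [||A [cA Ax] AUV] := @filtered_closed_sub_open F (U `|` V) F0 FI Fcl.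
  - exact: openU.
  - by rewrite -/K KBC; exact: setUSS.
  case: cA => AY cA cYA.
  have AUE : A `&` U = A `\` V.
    apply/seteqP; split=> y [Ay Uy]; split=> //.
      by move=> Vy; suff : set0 y by []; rewrite -UV0.
    by case: (AUV _ Ay).
  have FAU : F (A `&` U).
    split; last by split=> //; exact: BU.
    split; first by move=> y [/AY].
      by rewrite AUE setDE; apply: closedI => //; exact: open_closedC.
    suff -> : Y `\` (A `&` U) = (Y `\` A) `|` (A `&` ~` U).
      by apply: closedU => //; apply: closedI => //; exact: open_closedC.
    apply/seteqP; split=> y.
      move=> [Yy nAU]; have [Ay|nAy] := pselect (A y); [right|left] => //.
      by split=> // Uy; exact: nAU.
    by move=> [[Yy nA]|[Ay nU]]; split=> //; [case|exact: AY|case].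
  apply/seteqP; split=> // y Cy; rewrite -UV0.
  by have [|_ Uy] := (_ : K y) _ FAU; [rewrite KBC; right|split=> //; exact: CV].
move=> B B0 [C oC BC] [D cD BD].
have cB : closed B by rewrite BD; exact: closedI.
have cKB : closed (K `\` B).
  suff -> : K `\` B = K `&` ~` C by apply: closedI => //; exact: open_closedC.
  rewrite BC; apply/seteqP; split=> y [Ky nBy]; split=> //.
    by move=> Cy; apply: nBy; split.
  by move=> [].
have BK : B `<=` K by rewrite BC => y [].
(* [key] is applied to whichever of [B] and its complement in [K] contains [x]. *)
have [Bx|nBx] := pselect (B x).
  apply/seteqP; split=> // y Ky; apply: contrapT => nBy.
  suff : (K `\` B) y by rewrite (key B (K `\` B)) // ?setDIK // setDUK.
  by split.
have := key (K `\` B) B cKB cB; rewrite setDKI => /(_ erefl).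
rewrite setDKU // => /(_ erefl) /(_ (conj Kx nBx)) B00; case: B0 => y.
by rewrite B00.
Qed.

(** Compactness is used twice. The quasicomponent of a point of [P] is connected, so it misses [Q],
    and so does some clopen set around the point. Hence the clopen sets containing the trace of [Q]
    have an intersection missing [P], and one of them already misses [P]. *)
Lemma clopen_in_separation P Q : closed P -> closed Q -> P `<=` Y ->
  (forall K, closed K -> connected K -> K `<=` Y ->
     K `&` P !=set0 -> K `&` Q !=set0 -> False) ->
  exists2 A, clopen_in A & P `<=` A /\ A `&` Q = set0.
Proof.
move=> cP cQ PY PQ.
have clopen_at x : P x -> exists2 A, clopen_in A & A x /\ A `&` Q = set0.
  move=> Px.
  have [|||||A [cA Ax] AQ] :=
      @filtered_closed_sub_open [set A | clopen_in A /\ A x] (~` Q).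
  - by exists Y; split; [exact: clopen_inT|exact: PY].
  - by move=> A B [? ?] [? ?]; split=> //; exact: clopen_inI.
  - by move=> A [[]].
  - exact: closed_openC.
  - move=> y Ky Qy; apply: (PQ (\bigcap_(A in [set A | clopen_in A /\ A x]) A)).
    + by apply: closed_bigI => A [[]].
    + by apply: quasicomponent_connected; exact: PY.
    + by move=> z /(_ Y); apply; split; [exact: clopen_inT|exact: PY].
    + by exists x; split=> // A [].
    + by exists y.
  by exists A => //; split=> //; apply/disjoints_subset.
pose F := [set B | clopen_in B /\ Y `&` Q `<=` B].
have [|||||B [cB QB] BP] := @filtered_closed_sub_open F (~` P).
- by exists Y; split; [exact: clopen_inT|exact: subIsetl].
- move=> A B [? QA] [? QB]; split; first exact: clopen_inI.
  by move=> y Qy; split; [exact: QA|exact: QB].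
- by move=> A [[]].
- exact: closed_openC.
- move=> y Fy Py; have [A cA [Ay AQ]] := clopen_at _ Py.
  have [|//] := Fy (Y `\` A); split; first exact: clopen_inC.
  move=> z [Yz Qz]; split=> // Az; suff : set0 z by [].
  by rewrite -AQ.
exists (Y `\` B); first exact: clopen_inC.
split=> [x Px|]; first by split; [exact: PY|move=> /BP].
apply/seteqP; split=> // x [[Yx nBx] Qx]; apply: nBx; exact: QB.
Qed.

End CompactSeparation.

Lemma within_continuous_comp_in (U V W : topologicalType) (A : set U)
    (B : set V) (f : U -> V) (g : V -> W) : (forall x, A x -> B (f x)) ->
  {within A, continuous f} -> {within B, continuous g} ->
  {within A, continuous (g \o f)}.
Proof.
move=> fAB /subspace_continuousP cf /subspace_continuousP cg.
apply/subspace_continuousP => x Ax W' nW.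
have := cf x Ax _ (cg _ (fAB _ Ax) W' nW).
by apply: (@filterS _ (nbhs x)) => y /= fy Ay; exact: (fy Ay (fAB _ Ay)).
Qed.

(** * Subarcs of a parametrised arc *)

Section Arcs.
Variables (R : realType) (X : pseudoMetricType R).
Hypothesis hX : hausdorff_space X.

Definition arc_param (g : R -> X) :=
  {within `[0, 1], continuous g} /\ {in `[0, 1] &, injective g}.

Lemma is_arcP (A : set X) a b : is_arc A a b <->
  exists g, [/\ arc_param g, g @` `[0, 1] = A, g 0 = a & g 1 = b].
Proof.
split=> [[g [cg [ig [gA [g0 g1]]]]]|[g [[cg ig] gA g0 g1]]]; exists g.
  by split=> //; split=> // s t; exact: ig.
by do 3!split=> //; move=> s t; exact: ig.
Qed.

Variable g : R -> X.
Hypothesis gP : arc_param g.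

Lemma arc_sub_itv (s t : R) : 0 <= s -> t <= 1 -> `[s, t] `<=` `[0, 1].
Proof.
by move=> s0 t1 x; rewrite /= !in_itv /= => /andP[sx xt];
  rewrite (le_trans s0 sx) (le_trans xt t1).
Qed.

Lemma arc_itv_continuous (s t : R) : 0 <= s -> t <= 1 ->
  {within `[s, t], continuous g}.
Proof.
by move=> s0 t1; apply: continuous_subspaceW (gP.1); exact: arc_sub_itv.
Qed.

Lemma arc_itv_closed (s t : R) : 0 <= s -> t <= 1 -> closed (g @` `[s, t]).
Proof.
move=> s0 t1; apply: compact_closed => //; apply: continuous_compact.
  exact: arc_itv_continuous.
exact: segment_compact.
Qed.

Lemma arc_itv_connected (s t : R) : 0 <= s -> t <= 1 -> connected (g @` `[s, t]).
Proof.
move=> s0 t1; apply: connected_continuous_connected.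
  exact: segment_connected.
exact: arc_itv_continuous.
Qed.

Lemma arc_itv_subcontinuum (s t : R) : 0 <= s -> s <= t -> t <= 1 ->
  subcontinuum (g @` `[s, t]).
Proof.
move=> s0 st t1; split; first by exists (g s), s => //=; rewrite in_itv /= lexx st.
split; last exact: arc_itv_connected.
apply: continuous_compact; first exact: arc_itv_continuous.
exact: segment_compact.
Qed.

(** The images of [[0, t]] and [[t, 1]] meet only at [g t]. If [M] missed that point, it would lie
    in the first image and could not reach [g u]. *)
Lemma arc_connected_convex (M : set X) (s t u : R) :
  connected M -> M `<=` g @` `[0, 1] ->
  0 <= s -> s <= t -> t <= u -> u <= 1 -> M (g s) -> M (g u) -> M (g t).
Proof.
move=> cM Mg s0 st tu u1 Ms Mu; apply: contrapT => nMt.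
have t0 : 0 <= t by exact: le_trans st.
have t1 : t <= 1 by exact: le_trans u1.
have : M `<=` g @` `[0, t].
  apply: (connected_closed_sub cM (G := g @` `[t, 1])).
  - exact: arc_itv_closed.
  - exact: arc_itv_closed.
  - move=> x /Mg[w]; rewrite /= in_itv /= => /andP[w0 w1] <-.
    by have [wt|tw] := leP w t; [left|right]; exists w => //=;
      rewrite in_itv /= ?w0 ?wt // w1 ltW.
  - apply/seteqP; split=> // x [[Mx [w]]].
    rewrite /= in_itv /= => /andP[w0 wt] wx [w']; rewrite /= in_itv /= => /andP[tw' w'1].
    rewrite -wx => /(gP.2); rewrite !in_itv /= w0 w'1 (le_trans wt) // (le_trans t0) //.
    move=> /(_ isT isT) ww'; apply: nMt; suff <- : w = t by rewrite wx.
    by apply/eqP; rewrite eq_le wt /= -ww'.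
  - by exists (g s); split=> //; exists s => //=; rewrite in_itv /= s0.
move=> /(_ _ Mu)[w]; rewrite /= in_itv /= => /andP[w0 wt].
move=> /(gP.2); rewrite !in_itv /= w0 u1 (le_trans wt) // (le_trans t0) //.
move=> /(_ isT isT) wu; apply: nMt; suff -> : t = u by [].
by apply/eqP; rewrite eq_le tu /= -wu.
Qed.

Lemma arc_itv_meet (c : R) : 0 <= c <= 1 ->
  g @` `[0, c] `&` g @` `[c, 1] = [set g c].
Proof.
move=> /andP[c0 c1]; apply/seteqP; split=> [x|_ ->]; last first.
  by split; exists c => //=; rewrite in_itv /= lexx ?c0.
move=> [[s /=]]; rewrite in_itv /= => /andP[s0 sc] <- [t /=].
rewrite in_itv /= => /andP[ct t1] /(gP.2).
rewrite !in_itv /= s0 t1 (le_trans sc) // (le_trans c0) // => /(_ isT isT) ts.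
by congr g; apply/eqP; rewrite eq_le sc -ts ct.
Qed.

(* The affine reparametrisation runs backwards when [t < s]. *)
Lemma subarc (s t : R) : 0 <= s <= 1 -> 0 <= t <= 1 -> s != t ->
  is_arc (g @` `[Num.min s t, Num.max s t]) (g s) (g t).
Proof.
move=> /andP[s0 s1] /andP[t0 t1] st.
pose a u : R := s + u * (t - s).
have a01 (u : R) : `[0, 1]%classic u -> `[0, 1]%classic (a u).
  by rewrite /= !in_itv /= /a => /andP[u0 u1]; apply/andP; split; nra.
have ca : continuous a.
  move=> u; apply: cvgD; first exact: cvg_cst.
  by apply: cvgM; [exact: cvg_id|exact: cvg_cst].
apply/is_arcP; exists (g \o a); split.
- split.
    apply: within_continuous_comp_in a01 _ (gP.1).
    exact: continuous_subspaceT.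
  move=> u w u01 w01 /(gP.2) auw.
  have : a u = a w by apply: auw; [exact: a01|exact: a01].
  by move=> /addrI /mulIf; apply; rewrite subr_eq0 eq_sym.
- rewrite -image_comp; congr (_ @` _); apply/seteqP; split=> w /=.
    move=> [u]; rewrite /= !in_itv /= /a => /andP[u0 u1] <-.
    by have [sLt|tLs] := leP s t; apply/andP; split; nra.
  rewrite /= in_itv /= => /andP[w0 w1]; exists ((w - s) / (t - s)); last first.
    by rewrite /a divfK ?subr_eq0 1?eq_sym // addrC subrK.
  rewrite in_itv /=; move: w0 w1; have [sLt|tLs|E] := ltgtP s t => w0 w1.
  + by rewrite divr_ge0 ?ler_pdivrMr /=; lra.
  + by rewrite -[_ / _]opprK -mulNr -mulrN -invrN divr_ge0 ?ler_pdivrMr /=; lra.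
  + by rewrite E eqxx in st.
- by rewrite /a /= mul0r addr0.
- by rewrite /a /= mul1r addrC subrK.
Qed.

End Arcs.

(** * The order along the arcs issuing from the top *)

Section SmoothFan.
Variables (R : realType) (X : pseudoMetricType R) (v : X).
Hypothesis sfX : smooth_fan v.

Let hX : hausdorff_space X. Proof. by case: sfX => [[[[]]]]. Qed.
Let cX : compact [set: X]. Proof. by case: sfX => [[[[_ []]]]]. Qed.
Let arcX (x y : X) : x <> y -> exists A, is_arc A x y.
Proof. by case: sfX => [[[_ [+ _]] _] _]; exact. Qed.
Let uniX (A B : set X) : subcontinuum A -> subcontinuum B -> connected (A `&` B).
Proof. by case: sfX => [[[_ [_ +]] _] _]; exact. Qed.

Lemma top_unique (x : X) : ramification_point x -> x = v.
Proof. by case: sfX => [[_ +] [rv _]] rx; exact. Qed.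

Lemma arc_subcontinuum (A : set X) a b : is_arc A a b -> subcontinuum A.
Proof. by move=> /is_arcP[g [gP <- _ _]]; exact: arc_itv_subcontinuum. Qed.

(** By hereditary unicoherence the intersection is connected. It contains both ends, so by convexity
    it is all of either arc. *)
Lemma arc_unique (A B : set X) a b : is_arc A a b -> is_arc B a b -> A = B.
Proof.
suff sub (A' B' : set X) : is_arc A' a b -> is_arc B' a b -> A' `<=` B'.
  by move=> aA aB; apply/seteqP; split; exact: sub.
move=> aA aB; have cAB := uniX (arc_subcontinuum aA) (arc_subcontinuum aB).
move/is_arcP : aA => [g [gP gA g0 g1]]; move/is_arcP : aB => [h [_ hB h0 h1]].
move=> x; rewrite -gA => -[t /=]; rewrite in_itv /= => /andP[t0 t1] <-.
suff [] : (A' `&` B') (g t) by [].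
apply: (arc_connected_convex hX gP cAB (s := 0) (u := 1)) => //.
- by rewrite gA; exact: subIsetl.
- by rewrite -gA -hB; split; exists 0; rewrite /= ?in_itv /= ?lexx ?ler01 // h0.
- by rewrite -gA -hB; split; exists 1; rewrite /= ?in_itv /= ?lexx ?ler01 // h1.
Qed.

(* The arc [v, x], reduced to [v] when [x = v]. *)
Definition seg (x : X) : set X := [set y | exists2 A, varc v x A & A y].

Lemma varc_unique x (A B : set X) : varc v x A -> varc v x B -> A = B.
Proof.
move=> [[xv ->]|[xv aA]] [[xv' ->]|[xv' aB]] //.
exact: arc_unique aA aB.
Qed.

Lemma varc_seg x A : varc v x A -> seg x = A.
Proof.
move=> vA; apply/seteqP; split=> y; last by exists A.
by move=> [B vB]; rewrite (varc_unique vB vA).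
Qed.

Lemma segP x : varc v x (seg x).
Proof.
suff [A vA] : exists A, varc v x A by rewrite (varc_seg vA).
have [->|/eqP xv] := eqVneq x v; first by exists [set v]; left.
by have [|A aA] := @arcX v x; [exact/nesym|exists A; right].
Qed.

Lemma seg_top : seg v = [set v]. Proof. by apply: varc_seg; left. Qed.

Lemma seg_param x : x <> v ->
  exists g, [/\ arc_param g, g @` `[0, 1] = seg x, g 0 = v & g 1 = x].
Proof. by case: (segP x) => [[]//|[_ /is_arcP]]. Qed.

Lemma seg_itv g t : arc_param g -> g 0 = v -> 0 <= t <= 1 ->
  seg (g t) = g @` `[0, t].
Proof.
move=> gP g0 /andP[t0 t1]; apply: varc_seg.
have [->|/eqP tN0] := eqVneq t 0.
  by left; split=> //; rewrite set_itv1 image_set1 g0.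
have tpos : 0 < t by rewrite lt_neqAle t0 eq_sym andbT; apply/eqP.
right; split.
  rewrite -g0 => /(gP.2); rewrite !in_itv /= t0 t1 lexx ler01.
  by move=> /(_ isT isT).
have := @subarc _ _ _ gP 0 t; rewrite lexx ler01 t0 t1 g0 min_l // max_r //.
by apply=> //; rewrite lt_eqF.
Qed.

Lemma seg_subcontinuum x : subcontinuum (seg x).
Proof.
case: (segP x) => [[_ ->]|[_]]; last exact: arc_subcontinuum.
by split; [exists v|split; [exact: compact_set1|exact: connected1]].
Qed.

Lemma seg_closed x : closed (seg x).
Proof. by apply: compact_closed => //; case: (seg_subcontinuum x) => _ []. Qed.

Lemma seg_self x : seg x x.
Proof.
have [->|/eqP /seg_param[g [_ <- _ g1]]] := eqVneq x v.
  by rewrite seg_top.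
by exists 1; rewrite //= in_itv /= ler01 lexx.
Qed.

Lemma seg_v x : seg x v.
Proof.
have [->|/eqP /seg_param[g [_ <- <- _]]] := eqVneq x v.
  by rewrite seg_top.
by exists 0; rewrite //= in_itv /= ler01 lexx.
Qed.

Lemma seg_trans x y : seg y x -> seg x `<=` seg y.
Proof.
have [->|/eqP /seg_param[g [gP gy g0 g1]]] := eqVneq y v.
  by rewrite seg_top => ->; rewrite seg_top.
rewrite -gy => -[t /=]; rewrite in_itv /= => t01 <-.
rewrite seg_itv //; apply: image_subset; apply: arc_sub_itv => //.
by case/andP : t01.
Qed.

(* Otherwise the last common point of the two arcs would be a ramification
   point other than [v]. *)
Lemma seg_comparable x y z : x <> v -> seg y x -> seg z x ->
  seg y z \/ seg z y.
Proof.
move=> xv yx zx.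
have yv : y <> v by move=> yv; move: yx; rewrite yv seg_top.
have zv : z <> v by move=> zv; move: zx; rewrite zv seg_top.
have [g [gP gy g0 g1]] := seg_param yv.
have [h [hP hz h0 h1]] := seg_param zv.
(* The largest parameter [c] in this compact set gives the last point of [[v, y]] on [[v, z]]; [d]
   is its parameter on the other arc. *)
have kT : compact (`[0, 1] `&` g @^-1` (seg z)).
  apply: (subclosed_compact _ (@segment_compact R 0 1)); last exact: subIsetl.
  rewrite closed_setSI; last exact: interval_closed.
  by apply: preimage_closed; [move=> t _; exact: gP.1|exact: seg_closed].
have [||] := @compact_EVT_max _ _ id _ _ kT.
- by exists 0; split=> /=; [rewrite in_itv /= lexx ler01|rewrite g0; exact: seg_v].
- by apply: continuous_subspaceT => t; exact: cvg_id.
move=> c; rewrite inE => -[/=]; rewrite in_itv /= => c01 zgc cmax.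
have [c0 c1] := andP c01.
have [d /= + hdgc] : (h @` `[0, 1]) (g c) by rewrite hz.
rewrite in_itv /= => d01.
have [d0 d1] := andP d01.
have segc : seg (g c) = g @` `[0, c] by exact: seg_itv.
have segd : seg (g c) = h @` `[0, d] by rewrite -hdgc; exact: seg_itv.
have meet t : 0 <= t <= 1 -> seg z (g t) -> t <= c.
  by move=> t01 zt; apply: cmax; rewrite inE; split=> //=; rewrite in_itv.
(* The common point [x] has a parameter at most [c], so [c = 0] would give [x = v]. *)
have gcv : g c <> v.
  move=> gcv; move: yx; rewrite -gy => -[t /=]; rewrite in_itv /= => t01 gt.
  have tc : t <= c by apply: meet => //; rewrite gt.
  have cE0 : c = 0.
    by apply: (gP.2); rewrite ?in_itv /= ?lexx ?ler01 // gcv g0.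
  apply: xv; rewrite -gt -g0; congr g.
  by case/andP : t01 => t0 _; lra.
have [cE1|c1'] := eqVneq c 1; first by right; rewrite -g1; rewrite cE1 in zgc.
have [dE1|d1'] := eqVneq d 1.
  left; have <- : g c = z by rewrite -hdgc dE1.
  by rewrite -gy; exists c => //=; rewrite in_itv.
exfalso; apply: (gcv); apply: top_unique.
(* One branch of the triod returns to [v]; the other two meet only at [g c] because [c] is
   maximal. *)
exists (seg (g c)), (g @` `[c, 1]), (h @` `[d, 1]), v, y, z; split; split.
- have := @subarc _ _ _ gP c 0 c01; rewrite lexx ler01 min_r // max_l // g0.
  by rewrite segc; apply=> //; apply/eqP => cE0; apply: gcv; rewrite cE0 g0.
- have := @subarc _ _ _ gP c 1 c01; rewrite lexx ler01 min_l // max_r // g1.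
  exact.
- have := @subarc _ _ _ hP d 1 d01; rewrite lexx ler01 min_l // max_r // h1 hdgc.
  exact.
- by rewrite segc; exact: arc_itv_meet.
- by rewrite segd -hdgc; exact: arc_itv_meet.
- apply/seteqP; split=> [w|_ ->]; last first.
    by split; [exists c|exists d] => //=; rewrite in_itv /= lexx.
  move=> [[t /=]]; rewrite in_itv /= => /andP[ct t1] <- [u /=].
  rewrite in_itv /= => /andP[du u1] hugt; congr g; apply/eqP.
  rewrite eq_le ct andbT; apply: meet; first by rewrite t1 (le_trans c0).
  by rewrite -hz -hugt; exists u => //=; rewrite in_itv /= u1 (le_trans d0).
Qed.

(** If [[v, y]] and [[v, z]] meet only at [v], their union is a continuum whose intersection with
    [K] is connected. The two arcs have no common point in [K], so this intersection lies in one of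
    them. *)
Lemma connected_comparable (K : set X) y z : closed K -> connected K ->
  ~ K v -> K y -> K z -> seg y z \/ seg z y.
Proof.
move=> clK cK nKv Ky Kz.
have [[x [yx zx xv]]|nyz] := pselect (exists x, [/\ seg y x, seg z x & x <> v]).
  exact: seg_comparable xv yx zx.
have sK : subcontinuum K.
  by split; [exists y|split=> //; exact: subclosed_compact cX _].
have sM : subcontinuum (seg y `|` seg z).
  have [y0 [ky cy]] := seg_subcontinuum y; have [z0 [kz cz]] := seg_subcontinuum z.
  split; first by exists v; left; exact: seg_v.
  split; first exact: compactU.
  by apply: connectedU => //; exists v; split; exact: seg_v.
left; suff : K `&` (seg y `|` seg z) `<=` seg y.
  by apply; split=> //; right; exact: seg_self.
apply: (connected_closed_sub (uniX sK sM) (G := seg z)).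
- exact: seg_closed.
- exact: seg_closed.
- by move=> w [].
- apply/seteqP; split=> // w [[[Kw _] yw] zw]; apply: nyz; exists w; split=> //.
  by move=> wv; apply: nKv; rewrite -wv.
- by exists y; split; [split=> //; left; exact: seg_self|exact: seg_self].
Qed.

(** Some uniform neighbourhood of the compact arc [[v, x]] lies in [O]. Points tending to [x] whose
    arcs leave [O] would contradict the Hausdorff convergence given by smoothness. *)
Lemma seg_usc x (O : set X) : open O -> seg x `<=` O ->
  \forall y \near x, seg y `<=` O.
Proof.
move=> oO xO.
have [e e0 xeO] : exists2 e : R, 0 < e & eps_nbhd (seg x) e `<=` O.
  have [_ [/compact_near_coveringP kx _]] := seg_subcontinuum x.
  have /(kx _ 0^'+ (fun e s => ball s e `<=` O)) : forall s, seg x s ->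
      \forall s' \near s & e \near 0^'+, ball s' e `<=` O.
    move=> s /xO Os; have /nbhs_ballP[d /= d0 dO] : nbhs s O.
      exact: open_nbhs_nbhs.
    near=> s' e.
    have ss' : ball s (d / 2) s' by near: s'; apply: nbhsx_ballx; lra.
    have ed : e <= d / 2 by near: e; apply: nbhs_right_le; lra.
    move=> y s'y; apply: dO; rewrite (splitr d).
    exact: (ball_triangle ss' (le_ball ed s'y)).
  move=> xO'; have [e [e0 eO]] := filter_ex (filterI (nbhs_right_gt (0 : R)) xO').
  by exists e => // y [s xs]; exact: eO.
apply: contrapT => nx.
have /choice[u uP] : forall n : nat, exists y, ball x n.+1%:R^-1 y /\ ~ seg y `<=` O.
  move=> n; apply: contrapT => ny; apply: nx.
  apply/nbhs_ballP; exists n.+1%:R^-1; first by rewrite /= invr_gt0.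
  by move=> y xy; apply: contrapT => yO; apply: ny; exists y.
have ux : u @ \oo --> x.
  apply/cvg_ballP => d d0; near=> n; apply: (@le_ball _ _ _ n.+1%:R^-1).
    by apply: ltW; near: n; exact: near_infty_natSinv_lt (PosNum d0).
  by case: (uP n).
case: sfX => _ [_ smooth].
have /(_ e e0) := smooth x u (seg \o u) (seg x) ux (fun n => segP (u n)) (segP x).
move=> /filter_ex[n [un _]]; case: (uP n) => _; apply.
exact: subset_trans un xeO.
Unshelve. all: by end_near. Qed.

(** * Separating families of legs *)

Definition upper (Y : set X) := forall x y, Y x -> seg y x -> Y y.

(** Arcs from [v] with another common point are nested by [seg_comparable], so this says that no leg
    carries points of both sets other than [v]. *)
Definition legs_disjoint (P Q : set X) :=
  forall x y z, P y -> Q z -> seg y x -> seg z x -> x = v.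

(** A continuum in [Y] misses [v], so any two of its points are comparable and it cannot join [P] to
    [Q]. Hence [clopen_in_separation] applies. *)
Lemma legs_disjoint_extend (Y P Q : set X) : closed Y -> upper Y -> ~ Y v ->
  closed P -> closed Q -> P `<=` Y -> Q `<=` Y -> legs_disjoint P Q ->
  exists PQ : set X * set X, [/\ closed PQ.1, closed PQ.2,
    PQ.1 `|` PQ.2 = Y, P `<=` PQ.1 /\ Q `<=` PQ.2 & legs_disjoint PQ.1 PQ.2].
Proof.
move=> clY uY nYv clP clQ PY QY PQ.
have [|A [AY clA clYA] [PA AQ0]] := clopen_in_separation hX cX clY clP clQ PY.
  move=> K clK cK KY [y [Ky Py]] [z [Kz Qz]].
  have nKv : ~ K v by move/KY.
  case: (connected_comparable clK cK nKv Ky Kz) => [yz|zy].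
    have zv := PQ z y z Py Qz yz (seg_self z).
    by apply: nKv; rewrite -zv.
  have yv := PQ y y z Py Qz (seg_self y) zy.
  by apply: nKv; rewrite -yv.
(* As [Y] is upper, the arc from [y] to [z] stays in [Y]; being connected, it does not cross between
   [A] and its complement. *)
have below y z : Y y -> seg z y -> A y <-> A z.
  move=> Yy zy.
  have zv : z <> v by move=> zv; move: zy; rewrite zv seg_top => yv; rewrite yv in Yy.
  have [g [gP gz g0 g1]] := seg_param zv.
  move: (zy); rewrite -gz => -[t /=]; rewrite in_itv /= => /andP[t0 t1] gty.
  have cI : connected (g @` `[t, 1]) by exact: arc_itv_connected.
  have Iy : (g @` `[t, 1]) y by exists t => //=; rewrite in_itv /= lexx t1.
  have Iz : (g @` `[t, 1]) z by exists 1 => //=; rewrite in_itv /= lexx t1.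
  have IY : g @` `[t, 1] `<=` Y.
    move=> _ [u /= + <-]; rewrite in_itv /= => /andP[tu u1].
    apply: uY Yy _; rewrite seg_itv ?u1 ?(le_trans t0) //.
    by exists t => //=; rewrite in_itv /= t0.
  have IA : g @` `[t, 1] `<=` A `|` (Y `\` A).
    by move=> w /IY Yw; have [Aw|nAw] := pselect (A w); [left|right].
  have I0 : g @` `[t, 1] `&` A `&` (Y `\` A) = set0.
    by apply/seteqP; split=> // w [[_ Aw] [_]].
  have sub := connected_closed_sub cI clA clYA IA I0.
  by split=> [Ay|Az]; apply: sub => //; [exists y|exists z].
exists (A, Y `\` A); split=> //=.
- by rewrite setDUK.
- split=> // z Qz; split; first exact: QY.
  by move=> Az; suff : set0 z by []; rewrite -AQ0.
- move=> x y z Ay [Yz nAz] yx zx; apply: contrapT => xv.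
  case: (seg_comparable xv yx zx) => [yz|zy]; apply: nAz.
    by apply/(below z y).
  by apply/(below y z) => //; exact: AY.
Qed.

Lemma leg_separation (A B : set X) : closed A -> closed B -> ~ A v -> ~ B v ->
  legs_disjoint A B ->
  exists b : X -> bool, [/\ forall x, x <> v -> \forall y \near x, b y = b x,
    forall x y, A y -> seg y x -> x <> v -> b x = true &
    forall x y, B y -> seg y x -> x <> v -> b x = false].
Proof.
move=> clA clB nAv nBv AB.
(* Removing [A] and [B] from the shrinking neighbourhoods of [v] puts both sets into [Y n] from the
   first stage on. *)
pose O n : set X := (ball v n.+1%:R^-1)° `&` (~` A `&` ~` B).
pose Y n : set X := [set x | ~ seg x `<=` O n].
have oO n : open (O n).
  apply: openI; first exact: open_interior.
  by apply: openI; exact: closed_openC.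
have Ov n : O n v.
  split=> //; apply: nbhsx_ballx; by rewrite invr_gt0.
have clY n : closed (Y n).
  rewrite -[Y n]setCK; apply: open_closedC; rewrite openE => x /contrapT xO.
  by apply: filterS (seg_usc (oO n) xO) => y yO; apply.
have uY n : upper (Y n).
  by move=> x y Yx yx yO; apply: Yx; exact: subset_trans (seg_trans yx) yO.
have nYv n : ~ Y n v by apply; rewrite seg_top => _ ->.
have AY n : A `<=` Y n by move=> x Ax /(_ _ (seg_self x))[_ []].
have BY n : B `<=` Y n by move=> x Bx /(_ _ (seg_self x))[_ []].
have YS n : Y n `<=` Y n.+1.
  move=> x Yx xO; apply: Yx => y /xO [yO ?]; split=> //.
  apply: interiorS yO => z; apply: le_ball.
  by rewrite lef_pV2 ?posrE // ler_nat.
pose good n (s : set X * set X) :=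
  [/\ closed s.1, closed s.2, s.1 `|` s.2 = Y n & legs_disjoint s.1 s.2].
(* Each splitting of [Y n] extends to one of [Y n.+1]. Pairs that are not [good] get an arbitrary
   value, so that the choice function is total. *)
have /choice[nxt nxtP] : forall ns : nat * (set X * set X), exists s',
    good ns.1 ns.2 -> [/\ good ns.1.+1 s', ns.2.1 `<=` s'.1 & ns.2.2 `<=` s'.2].
  move=> [n s] /=; have [[c1 c2 sY ds]|] := pselect (good n s); last by exists s.
  have [||s' [c1' c2' sY' [s1 s2] ds']] :=
      legs_disjoint_extend (clY n.+1) (@uY n.+1) (@nYv n.+1) c1 c2 _ _ ds.
  - by apply: subset_trans (@YS n); rewrite -sY; exact: subsetUl.
  - by apply: subset_trans (@YS n); rewrite -sY; exact: subsetUr.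
  by exists s'.
have [s0 [c1 c2 s0Y [As0 Bs0] ds0]] :=
  legs_disjoint_extend (clY 0) (@uY 0) (@nYv 0) clA clB (@AY 0) (@BY 0) AB.
pose S := fix S n := if n is m.+1 then nxt (m, S m) else s0.
have SP n : good n (S n) by elim: n => //= n /(nxtP (n, S n))[].
have S1 m n : (m <= n)%N -> (S m).1 `<=` (S n).1.
  elim: n => [|n IH]; first by rewrite leqn0 => /eqP ->.
  rewrite leq_eqVlt => /orP[/eqP -> //|/IH mn].
  by apply: subset_trans mn _; case: (nxtP (n, S n) (SP n)).
have S2 m n : (m <= n)%N -> (S m).2 `<=` (S n).2.
  elim: n => [|n IH]; first by rewrite leqn0 => /eqP ->.
  rewrite leq_eqVlt => /orP[/eqP -> //|/IH mn].
  by apply: subset_trans mn _; case: (nxtP (n, S n) (SP n)).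
have Sv n x y z : (S n).1 y -> (S n).2 z -> seg y x -> seg z x -> x = v.
  by case: (SP n) => _ _ _; exact.
have nv n x : (S n).1 x -> (S n).2 x -> False.
  move=> S1x S2x; apply: (@nYv n); rewrite -(Sv n x x x S1x S2x (seg_self x) (seg_self x)).
  by case: (SP n) => _ _ <- _; left.
(* A whole neighbourhood of [x] enters a single [Y n], where the splitting is clopen; this makes the
   limit digit locally constant. *)
have Yev x : x <> v -> exists n, \forall y \near x, Y n y.
  move=> /eqP xv; move: hX; rewrite open_hausdorff => /(_ _ _ xv).
  move=> [[U V] /= [/set_mem Ux /set_mem Vv] [oU oV /eqP UV0]].
  have /nbhs_ballP[e /= e0 eV] : nbhs v V by exact: open_nbhs_nbhs.
  have [n _ /(_ n (leqnn n)) ne] := near_infty_natSinv_lt (PosNum e0).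
  exists n; have : nbhs x U by exact: open_nbhs_nbhs.
  apply: filterS => y Uy /(_ _ (seg_self y))[/interior_subset yb _].
  suff : set0 y by []; rewrite -UV0; split=> //; apply: eV.
  by apply: le_ball yb; exact: ltW.
(* Both halves grow with [n], so a point never changes sides: two stages are compared at their
   maximum. *)
exists (fun x => `[< exists n, (S n).1 x >]); split.
- move=> x xv; have [n Yn] := Yev x xv.
  have := nbhs_singleton Yn; case: (SP n) => c1n c2n SY _; rewrite -SY => -[Sx|Sx].
  + have nS2 : \forall y \near x, (~` (S n).2) y.
      apply: open_nbhs_nbhs; split; first exact: closed_openC.
      by move=> /(nv _ _ Sx).
    have trueP y : (S n).1 y -> `[< exists n, (S n).1 y >] = true.
      by move=> Sy; apply/asboolP; exists n.
    near=> y; rewrite !trueP //.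
    have : Y n y by near: y.
    by rewrite -SY => -[//|]; have : (~` (S n).2) y by near: y.
  + have nS1 : \forall y \near x, (~` (S n).1) y.
      apply: open_nbhs_nbhs; split; first exact: closed_openC.
      by move=> S1x; exact: (nv _ _ S1x Sx).
    have falseP y : (S n).2 y -> `[< exists n, (S n).1 y >] = false.
      move=> Sy; apply/asboolPn => -[m Smy].
      apply: (nv (maxn m n) y).
        by apply: S1 Smy; exact: leq_maxl.
      by apply: S2 Sy; exact: leq_maxr.
    near=> y; rewrite !falseP //.
    have : Y n y by near: y.
    by rewrite -SY => -[|//]; have : (~` (S n).1) y by near: y.
- move=> x y Ay yx xv; apply/asboolP; have [n Yn] := Yev x xv.
  exists n; have := nbhs_singleton Yn; case: (SP n) => _ _ <- _ [//|S2x].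
  case: xv; apply: (Sv n x y x) => //; last exact: seg_self.
  by apply: (S1 0%N) => //; exact: As0.
- move=> x y By yx xv; apply/asboolPn => -[n S1x].
  case: xv; apply: (Sv n x x y) => //; last exact: seg_self.
  by apply: (S2 0%N) => //; exact: Bs0.
Unshelve. all: by end_near. Qed.

End SmoothFan.

(** * Ternary expansions and coordinates on the Cantor fan *)

Section Ternary.
Variable R : realType.
Implicit Types d : nat -> bool.

Definition tsum d (n : nat) : R := \sum_(0 <= k < n) (((d k)%:R * 2) / 3 ^+ k.+1).

Definition ternary d : R := limn (tsum d).

(** Splitting off the leading digit exhibits the self-similarity of the Cantor set, which drives the
    inductions below. *)
Lemma tsumS d n : tsum d n.+1 = ((d 0%N)%:R * 2 + tsum (d \o S) n) / 3.
Proof.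
rewrite /tsum big_nat_recl // mulrDl expr1 mulr_suml; congr (_ + _).
by apply: eq_bigr => k _ /=; rewrite [3 ^+ k.+2]exprSr invfM mulrA.
Qed.

Lemma tsum_bound d n : 0 <= tsum d n <= 1.
Proof.
elim: n d => [|n IH] d; first by rewrite /tsum big_nil lexx ler01.
by rewrite tsumS; have /andP[? ?] := IH (d \o S); case: (d 0%N) => /=; lra.
Qed.

Lemma tsum_cvg d : tsum d @ \oo --> ternary d.
Proof.
apply: nondecreasing_is_cvgn; last first.
  by exists 1 => _ [n _ <-]; case/andP : (tsum_bound d n).
apply/nondecreasing_seqP => n; rewrite /tsum big_nat_recr //= lerDl.
by rewrite divr_ge0 ?mulr_ge0 ?exprn_ge0.
Qed.

Lemma ternary_bound d : 0 <= ternary d <= 1.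
Proof.
apply/andP; split.
  by apply: limr_ge; [exact: tsum_cvg|apply: nearW => n; case/andP : (tsum_bound d n)].
by apply: limr_le; [exact: tsum_cvg|apply: nearW => n; case/andP : (tsum_bound d n)].
Qed.

Lemma ternaryS d : ternary d = ((d 0%N)%:R * 2 + ternary (d \o S)) / 3.
Proof.
have := @tsum_cvg d; rewrite -cvg_shiftS.
rewrite (_ : [sequence _]_n = fun n => ((d 0%N)%:R * 2 + tsum (d \o S) n) / 3);
  last by apply: funext => n; exact: tsumS.
move=> /cvg_lim <- //; apply: cvg_lim => //.
by apply: cvgMl; apply: cvgD; [exact: cvg_cst|exact: tsum_cvg].
Qed.

Lemma cantor_setP c : cantor_set c <-> exists d, c = ternary d.
Proof.
split=> [[d dc]|[d ->]]; exists d; last exact: tsum_cvg.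
by apply/esym/cvg_lim.
Qed.

Lemma ternary_close d d' n : (forall k, (k < n)%N -> d k = d' k) ->
  `|ternary d - ternary d'| <= 3^-1 ^+ n.
Proof.
elim: n d d' => [|n IH] d d' dd'.
  rewrite expr0; have /andP[? ?] := ternary_bound d.
  by have /andP[? ?] := ternary_bound d'; rewrite ler_norml; lra.
rewrite ternaryS [ternary d']ternaryS dd' // -mulrBl opprD addrACA subrr add0r.
rewrite normrM [`|3^-1|]ger0_norm ?invr_ge0 // exprSr ler_wpM2r ?invr_ge0 //.
by apply: IH => k kn; exact: dd'.
Qed.

(** A leading digit [false] puts the value in [[0, 1/3]], and [true] in [[2/3, 1]]. So the value
    determines the first digit, then that of the shifted sequence, and so on. *)
Lemma ternary_inj : injective ternary.
Proof.
suff eqn n : forall d d', ternary d = ternary d' -> d n = d' n.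
  by move=> d d' dd'; apply: funext => n; exact: eqn.
have head d d' : ternary d = ternary d' ->
    d 0%N = d' 0%N /\ ternary (d \o S) = ternary (d' \o S).
  rewrite ternaryS [ternary d']ternaryS.
  have /andP[? ?] := ternary_bound (d \o S).
  have /andP[? ?] := ternary_bound (d' \o S).
  by case: (d 0%N); case: (d' 0%N) => /= ?; split=> //; lra.
by elim: n => [|n IH] d d' /head[// _ /IH].
Qed.

(** A general filter lets this serve both the Cantor space and the locally constant digits on the
    fan. *)
Lemma ternary_cvg (T : Type) (F : set_system T) (c : T -> nat -> bool) d :
  Filter F -> (forall k, \forall y \near F, c y k = d k) ->
  ternary (c y) @[y --> F] --> ternary d.
Proof.
move=> FF cd.
have prefix n : \forall y \near F, forall k, (k < n)%N -> c y k = d k.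
  elim: n => [|n IH]; first by apply: nearW.
  apply: filterS2 IH (cd n) => y lt_eq n_eq k.
  by rewrite ltnS leq_eqVlt => /orP[/eqP ->|/lt_eq].
apply/cvgrPdist_lt => e e0.
have : (fun n => 3^-1 ^+ n : R) @ \oo --> (0 : R).
  by apply: cvg_expr; rewrite ger0_norm ?invr_ge0 // invf_lt1 // ltr1n.
move=> /cvgrPdist_lt/(_ e e0)[n _ /(_ n (leqnn n))].
rewrite sub0r normrN ger0_norm ?exprn_ge0 ?invr_ge0 // => ne.
apply: filterS (prefix n) => y ydn; apply: le_lt_trans ne.
by apply: ternary_close => k kn; rewrite ydn.
Qed.

Lemma ternary_continuous : continuous (ternary : cantor_space -> R).
Proof.
move=> d; apply: ternary_cvg => k.
exact: (@proj_continuous nat (fun=> bool) k d [set d k]).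
Qed.

Definition fan_point d (t : R) : R * R := ((1 - t) / 2 + t * ternary d, t).

Lemma std_cantor_fanP p : std_cantor_fan p <->
  exists d t, 0 <= t <= 1 /\ p = fan_point d t.
Proof.
split=> [[c [t [/cantor_setP[d ->] t01 ->]]]|[d [t [t01 ->]]]].
  by exists d, t.
by exists (ternary d), t; split=> //; apply/cantor_setP; exists d.
Qed.

(** All legs share the apex [(1/2, 0)], so the digits can be recovered only at nonzero height. *)
Lemma fan_point_inj d d' t t' : fan_point d t = fan_point d' t' ->
  t = t' /\ (t <> 0 -> d = d').
Proof.
move=> [+ tt']; rewrite -tt' => /addrI E; split=> // /eqP t0.
by apply: ternary_inj; apply: (mulfI t0).
Qed.

(** Only the product has to converge: near the top the digits may have no limit while the height
    tends to 0. *)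
Lemma fan_point_cvg (T : Type) (F : set_system T) (c : T -> nat -> bool)
    (s : T -> R) d (t : R) : Filter F -> s y @[y --> F] --> t ->
  s y * ternary (c y) @[y --> F] --> t * ternary d ->
  fan_point (c y) (s y) @[y --> F] --> fan_point d t.
Proof.
move=> FF st sct.
have sct' : (1 - s y) / 2 + s y * ternary (c y) @[y --> F]
    --> (1 - t) / 2 + t * ternary d.
  by apply: cvgD sct; apply: cvgMl; apply: cvgB st; exact: cvg_cst.
exact: (cvg_pair sct' st).
Qed.

End Ternary.

(** * The retraction onto an embedded planar Cantor fan *)

Section Retraction.
Variables (R : realType) (X : pseudoMetricType R) (v : X).
Hypothesis sfX : smooth_fan v.
Variables (q : R * R -> X) (qi : X -> R * R).
Hypothesis fan_compact : compact (@std_cantor_fan R).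
Hypothesis q_cont : {within @std_cantor_fan R, continuous q}.
Hypothesis qi_cont : {within q @` @std_cantor_fan R, continuous qi}.
Hypothesis qK : forall p, std_cantor_fan p -> qi (q p) = p.

Let hX : hausdorff_space X. Proof. by case: sfX => [[[[]]]]. Qed.
Let cX : compact [set: X]. Proof. by case: sfX => [[[[_ []]]]]. Qed.

Let leg (d : nat -> bool) (t : R) : X := q (fan_point d t).

Let fan_pointP d (t : R) : 0 <= t <= 1 -> std_cantor_fan (fan_point d t).
Proof. by move=> t01; apply/std_cantor_fanP; exists d, t. Qed.

Let leg_inj d d' t t' : 0 <= t <= 1 -> 0 <= t' <= 1 -> leg d t = leg d' t' ->
  t = t' /\ (t <> 0 -> d = d').
Proof.
move=> t01 t01' /(congr1 qi); rewrite /leg !qK; first exact: fan_point_inj.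
  exact: fan_pointP.
exact: fan_pointP.
Qed.

Let leg_param d : arc_param (leg d).
Proof.
split.
  apply: within_continuous_comp_in q_cont.
    by move=> t /=; rewrite in_itv /= => t01; exact: fan_pointP.
  apply: continuous_subspaceT => t; apply: fan_point_cvg; first exact: cvg_id.
  by apply: cvgMl; exact: cvg_id.
move=> s t; rewrite !in_itv /= => s01 t01 E.
by case: (leg_inj s01 t01 E).
Qed.

Let leg0_indep d d' : leg d 0 = leg d' 0.
Proof. by rewrite /leg /fan_point !mul0r. Qed.

Let leg0 d : leg d 0 = v.
Proof.
apply: (top_unique sfX).
(* Three legs form a triod at the image of the apex. The sequence [d1] differs from the other two at
   digit 0, and [d2] differs from [d3] at digit 1. *)
pose d1 : nat -> bool := fun=> false; pose d2 : nat -> bool := fun=> true.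
pose d3 : nat -> bool := fun n => n == 0%N.
have arc_leg d' : is_arc (leg d' @` `[0, 1]) (leg d 0) (leg d' 1).
  by apply/is_arcP; exists (leg d').
have meet (d' d'' : nat -> bool) n : d' n <> d'' n ->
    leg d' @` `[0, 1] `&` leg d'' @` `[0, 1] = [set leg d 0].
  move=> nd; apply/seteqP; split=> [_ [[s /= + <-] [t /=]]|_ ->].
    rewrite !in_itv /= => s01 t01 E; have [ts td] := leg_inj t01 s01 E.
    have [t0|/eqP t0] := eqVneq t 0; first by rewrite -ts t0; exact: leg0_indep.
    by case: nd; rewrite (td t0).
  by split; exists 0; rewrite //= in_itv /= lexx ler01.
exists (leg d1 @` `[0, 1]), (leg d2 @` `[0, 1]), (leg d3 @` `[0, 1]).
exists (leg d1 1), (leg d2 1), (leg d3 1); split; split=> //.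
- exact: (meet _ _ 0%N).
- exact: (meet _ _ 0%N).
- exact: (meet _ _ 1%N).
Qed.

Let seg_leg d t : 0 <= t <= 1 -> seg v (leg d t) = leg d @` `[0, t].
Proof. exact: seg_itv. Qed.

Let ends n (b : bool) : set X := (leg^~ 1) @` [set d : nat -> bool | d n = b].

(** This is a continuous image of a closed, hence compact, subset of the Cantor space. *)
Let ends_closed n b : closed (ends n b).
Proof.
apply: compact_closed => //.
apply: (@continuous_compact cantor_space X (leg^~ 1)).
  apply: within_continuous_comp_in q_cont.
    by move=> d _; apply: fan_pointP; rewrite ler01 lexx.
  apply: continuous_subspaceT => d; apply: fan_point_cvg; first exact: cvg_cst.
  by apply: cvgMr; exact: ternary_continuous.
apply: subclosed_compact cantor_space_compact _ => //.
apply: (@closed_comp cantor_space bool (@proj nat (fun=> bool) n) [set b]).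
  by move=> d _; exact: proj_continuous.
exact: discrete_closed.
Qed.

Lemma cantor_fan_retract : exists r : X -> X,
  [/\ continuous r, forall y, (q @` @std_cantor_fan R) (r y) &
      forall y, (q @` @std_cantor_fan R) y -> r y = y].
Proof.
have I01 : 0 <= (1 : R) <= 1 by rewrite ler01 lexx.
have I00 : 0 <= (0 : R) <= 1 by rewrite ler01 lexx.
have endsNv n b : ~ ends n b v.
  move=> [d _]; rewrite -(leg0 d) => /(leg_inj I01 I00)[E _].
  by have := @oner_neq0 R; rewrite E eqxx.
have ends_disj n : legs_disjoint v (ends n true) (ends n false).
  move=> x _ _ [d dn <-] [d' dn' <-]; rewrite !seg_leg //.
  move=> [s /=]; rewrite in_itv /= => s01 <- [t /=]; rewrite in_itv /= => t01 E.
  have [ts td] := leg_inj t01 s01 E.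
  have [t0|/eqP t0] := eqVneq t 0; first by rewrite -ts t0 leg0.
  by move: dn dn'; rewrite /= (td t0) => ->.
have /choice[b bP] n := leg_separation sfX (@ends_closed n true)
  (@ends_closed n false) (@endsNv n true) (@endsNv n false) (@ends_disj n).
pose c x n := b n x.
have c_leg d t : 0 < t <= 1 -> c (leg d t) = d.
  move=> /andP[t0 t1]; apply: funext => n; rewrite /c.
  have t01 : 0 <= t <= 1 by rewrite ltW.
  have below : seg v (leg d 1) (leg d t).
    by rewrite seg_leg //; exists t => //=; rewrite in_itv.
  have nv : leg d t <> v.
    rewrite -(leg0 d) => /(leg_inj t01 I00)[E _].
    by rewrite E ltxx in t0.
  have [_ bt bf] := bP n; case E : (d n).
    by apply: (bt _ (leg d 1)) => //; exists d.
  by apply: (bf _ (leg d 1)) => //; exists d.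
have clD : closed (q @` @std_cantor_fan R).
  by apply: compact_closed => //; exact: continuous_compact.
have h_cont : {within q @` @std_cantor_fan R, continuous (fun y => (qi y).2)}.
  apply: (@within_continuous_comp _ _ _ _ qi (@snd R R)) => // p _.
  exact: cvg_snd.
have h_bound y : (q @` @std_cantor_fan R) y -> `|(qi y).2| <= 1.
  move=> [p Fp <-]; rewrite qK //.
  by move/std_cantor_fanP : Fp => [d [t [/andP[t0 t1] ->]]]; rewrite ger0_norm.
(* Tietze's theorem gives values in [[-1, 1]]; the absolute value moves them into [[0, 1]] without
   changing the heights on the embedded fan. *)
have [G [Gh cG G1]] := continuous_bounded_extension (compact_normal hX cX) clD
  ltr01 h_cont h_bound.
pose s x := `|G x|.
have cs : continuous s by move=> x; apply: cvg_norm; exact: cG.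
have s01 x : 0 <= s x <= 1 by rewrite normr_ge0 G1.
have s_leg d t : 0 <= t <= 1 -> s (leg d t) = t.
  move=> t01; have Ft := @fan_pointP d t t01.
  have := Gh (leg d t); rewrite /leg qK // => /(_ _) Gt.
  rewrite /s /leg -Gt; last by rewrite inE; exists (fan_point d t).
  by rewrite ger0_norm //; case/andP : t01.
have sv : s v = 0 by rewrite -(leg0 (fun=> true)) s_leg.
(* Away from [v] each digit is locally constant. At [v] the product is bounded by [s], which tends
   to 0. *)
have cw : continuous (fun x => s x * ternary R (c x)).
  move=> x; have [->|/eqP xv] := eqVneq x v; last first.
    apply: cvgM; first exact: cs.
    by apply: ternary_cvg => k; case: (bP k) => + _ _; exact.
  rewrite /continuous_at sv mul0r; apply/cvgr0Pnorm_le => e e0.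
  have := cs v; rewrite /continuous_at sv => /cvgr0Pnorm_le/(_ e e0).
  apply: filterS => y.
  apply: le_trans; rewrite normrM ler_piMr //.
  by have /andP[? ?] := ternary_bound R (c y); rewrite ger0_norm.
exists (fun x => leg (c x) (s x)); split.
- apply/continuous_subspace_setT.
  apply: within_continuous_comp_in q_cont; first by move=> x _; exact: fan_pointP.
  apply: continuous_subspaceT => x.
  by apply: fan_point_cvg; [exact: cs|exact: cw].
- by move=> y; exists (fan_point (c y) (s y)) => //; exact: fan_pointP.
- move=> _ [p /std_cantor_fanP[d [t [t01 ->]]] <-]; rewrite -/(leg d t) s_leg //.
  (* At height 0 the digits given by [c] may differ from [d], but both legs start at the apex. *)
  have [->|t0] := eqVneq t 0; first exact: leg0_indep.
  by case/andP : t01 => tge0 t1; rewrite c_leg // t1 andbT lt_def t0.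
Qed.

End Retraction.

(** * Transfer from the planar model to an arbitrary Cantor fan *)

Theorem mainTheorem4 (R : realType) (C L : pseudoMetricType R) :
  cantor_fan C -> lelek_fan L ->
  forall f : C -> L, embedding f ->
  exists r : L -> L,
    [/\ continuous r, (forall y, range f (r y)) & (forall y, range f y -> r y = y)].
Proof.
move=> [[_ [cC _]] [h [[ch [ih [hi [chi hK]]]] hF]]] [v [sfL _]] f.
move=> [cf [_ [fi [cfi fK]]]].
pose q := f \o hi; pose qi := h \o fi.
have qF : q @` @std_cantor_fan R = range f.
  rewrite -hF; apply/seteqP; split=> [_ [_ [x _ <-] <-]|_ [x _ <-]].
    by exists (hi (h x)).
  by exists (h x); [exists x|rewrite /q /= hK].
have [||||r rP] := @cantor_fan_retract R L v sfL q qi.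
- rewrite -hF; apply: continuous_compact => //; exact: continuous_subspaceT.
- rewrite -hF; apply: within_continuous_comp => // x _; exact: cf.
- rewrite qF; apply: within_continuous_comp => // x _; exact: ch.
- by move=> p; rewrite -hF => -[x _ <-]; rewrite /q /qi /= hK fK.
by exists r; move: rP; rewrite qF.
Qed.
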